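(* Let $p\in[1,\infty)$. Assume that $\nu$ is a non-negative, radially symmetric function on $\mathbb{R}^d$ with $\int_{\mathbb{R}^d}(1\wedge|x|^p)\,\nu(x)\,\mathrm{d}x<\infty$, whose radial profile has lower Matuszewska index at zero strictly bigger than $-d-1$ and lower Matuszewska index at infinity strictly bigger than $-d-1$. Then there is a constant $c>0$ such that for all $f\in L^p(\mathbb{R}^d)$, $$\left(\int_{\mathbb{R}^d} |f(x)|^p L(|x|)\,\mathrm{d}x\right)^{1/p} \le c\left(\int_{\mathbb{R}^d}\int_{\mathbb{R}^d} |f(x)-f(y)|^p\,\nu(x-y)\,\mathrm{d}x\,\mathrm{d}y\right)^{1/p}.$$
   Context: Functions are measurable. A radially symmetric function $\nu$ is identified with its radial profile, $\nu(x)=\nu(|x|)$. For $r>0$, $L(r)=\int_{\{|y|\ge r\}}\nu(y)\,\mathrm{d}y$. Lower Matuszewska indices: for a function $\varphi:(0,\infty)\to(0,\infty)$ and $a\in\mathbb{R}$, consider the inequality $$\frac{\varphi(r_2)}{\varphi(r_1)}\ge A\left(\frac{r_2}{r_1}\right)^{a}.\qquad( * )$$ The lower Matuszewska index of $\varphi$ at zero is the supremum of those $a\in\mathbb{R}$ for which there exist $A,R_0>0$ such that $( * )$ holds whenever $0<r_1<r_2<R_0$. The lower Matuszewska index of $\varphi$ at infinity is the supremum of those $a\in\mathbb{R}$ for which there exist $A,R_0>0$ such that $( * )$ holds whenever $R_0<r_1<r_2$. *)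

(* Defs.v *)
From HB Require Import structures.
From mathcomp Require Import all_boot all_order all_algebra.
From mathcomp Require Import all_classical all_reals all_analysis.

Set Implicit Arguments.
Unset Strict Implicit.
Unset Printing Implicit Defensive.

Import Order.TTheory GRing.Theory Num.Theory.
Import numFieldNormedType.Exports.

Local Open Scope classical_set_scope.
Local Open Scope ring_scope.

(* R^d with the product sigma-algebra of tuples, i.e. its Borel sigma-algebra.
   The coordinates are typed [measurableTypeR R], which is convertible to [R]
   but carries the measurable structure on which [lebesgue_measure] lives. *)
Notation Rvec R d := (d.-tuple (measurableTypeR R)).

Section measure_tuple_step.
Context d (T : measurableType d) (R : realType) (n : nat).
Variable m1 : {sigma_finite_measure set T -> \bar R}.
Variable m : {sigma_finite_measure set (n.-tuple T) -> \bar R}.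

Definition tuple_cons (t : T * n.-tuple T) : n.+1.-tuple T :=
  [tuple of t.1 :: t.2].

Lemma measurable_tuple_cons : measurable_fun [set: T * n.-tuple T] tuple_cons.
Proof. exact: measurable_cons. Qed.

Definition measure_tupleS : set (n.+1.-tuple T) -> \bar R :=
  pushforward (m1 \x m)%E tuple_cons.

Let measure_tupleS0 : measure_tupleS set0 = 0%E.
Proof. by rewrite /measure_tupleS /pushforward preimage_set0 measure0. Qed.

Let measure_tupleS_ge0 A : (0 <= measure_tupleS A)%E.
Proof. by rewrite /measure_tupleS /pushforward measure_ge0. Qed.

Let measure_tupleS_sigma_additive : semi_sigma_additive measure_tupleS.
Proof.
move=> F mF tF mUF; rewrite /measure_tupleS /pushforward preimage_bigcup.
apply: measure_semi_sigma_additive.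
- by move=> k; rewrite -[X in measurable X]setTI; exact: measurable_tuple_cons.
- apply/trivIsetP => /= i j _ _ ij; rewrite -preimage_setI.
  by move/trivIsetP : tF => /(_ _ _ _ _ ij) ->//; rewrite preimage_set0.
- by rewrite -preimage_bigcup -[X in measurable X]setTI;
    exact: measurable_tuple_cons.
Qed.

HB.instance Definition _ := isMeasure.Build _ _ _ measure_tupleS
  measure_tupleS0 measure_tupleS_ge0 measure_tupleS_sigma_additive.

Let measure_tupleS_sigma_finite : sigma_finite setT measure_tupleS.
Proof.
have /sigma_finiteP[F [TF ndF Foo]] := sigma_finiteT m1.
have /sigma_finiteP[G [TG ndG Goo]] := sigma_finiteT m.
pose g (t : n.+1.-tuple T) : T * n.-tuple T := (thead t, [tuple of behead t]).
have gK : cancel tuple_cons g.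
  by case=> x t; rewrite /g/= theadE; congr pair; exact/val_inj.
have mg : measurable_fun setT g.
  apply/measurable_fun_pairP; split.
    exact: measurable_tnth.
  exact: measurable_behead.
exists (fun k => g @^-1` (F k `*` G k)).
  apply/seteqP; split => // t _.
  have [i _ Fi] : (\bigcup_i F i) (g t).1 by rewrite -TF.
  have [j _ Gj] : (\bigcup_i G i) (g t).2 by rewrite -TG.
  exists (maxn i j) => //; split.
    by move: Fi; exact/subsetPset/ndF/leq_maxl.
  by move: Gj; exact/subsetPset/ndG/leq_maxr.
move=> k; have [mFk Fk] := Foo k; have [mGk Gk] := Goo k; split.
  rewrite -[X in measurable X]setTI; apply: mg => //; exact: measurableX.
rewrite /measure_tupleS /pushforward -comp_preimage.
rewrite (_ : g \o tuple_cons = idfun); last by apply/funext => t /=; rewrite gK.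
by rewrite preimage_id product_measure1E// lte_mul_pinfty// ge0_fin_numE.
Qed.

HB.instance Definition _ := Measure_isSigmaFinite.Build _ _ _ measure_tupleS
  measure_tupleS_sigma_finite.

End measure_tuple_step.

(* Lebesgue measure on R^d: the Dirac mass on the one-point space R^0, and
   lebesgue(R) \x lebesgue(R^n) transported along (x, t) |-> x :: t on R^n.+1. *)
Fixpoint lebesgue_tuple (R : realType) (d : nat) :
    {sigma_finite_measure set (Rvec R d) -> \bar R} :=
  match d with
  | 0 => @dirac _ (Rvec R 0) [tuple] R
  | n.+1 => measure_tupleS (@lebesgue_measure R) (lebesgue_tuple R n)
  end.

Lemma lebesgue_tuple_box (R : realType) (d : nat) (A : 'I_d -> set R) :
  (forall i, measurable (A i)) ->
  lebesgue_tuple R d [set t | forall i, A i (tnth t i)] =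
  (\prod_(i < d) lebesgue_measure (A i))%E.
Proof.
elim: d A => [A _|n IH A mA] /=.
  by rewrite big_ord0 diracE mem_set// => -[].
rewrite big_ord_recl -(IH (fun i => A (lift ord0 i)))//.
rewrite -product_measure1E//; [|exact: mA|]; last first.
  rewrite [X in measurable X](_ : _ = \big[setI/setT]_(i < n)
      (setT `&` (fun t : Rvec R n => tnth t i) @^-1` A (lift ord0 i))).
    apply: bigsetI_measurable => i _; apply: measurable_tnth => //; exact: mA.
  rewrite -bigcap_seq; apply/seteqP; split => t /=.
    by move=> H i _; split => //; exact: H.
  by move=> H i; have [] := H i (mem_index_enum i).
rewrite /measure_tupleS /pushforward; congr product_measure1.
apply/seteqP; split => -[x t] /=.
  move=> H; split; first by have := H ord0.
  by move=> i; have := H (lift ord0 i); rewrite tnthS.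
by move=> [Hx Ht] i; case: (unliftP ord0 i) => [j ->|->//]; rewrite tnthS.
Qed.

Section euclidean.
Context (R : realType) (d : nat).
Implicit Types x y : Rvec R d.

Definition tuple_sub x y : Rvec R d := [tuple (tnth x i : R) - tnth y i | i < d].

Definition enorm x : R := Num.sqrt (\sum_(i < d) (tnth x i : R) ^+ 2).

(* The tail function L(r) of nu. It may be +oo at r = 0. *)
Definition tail_integral (nu : Rvec R d -> R) (r : R) : \bar R :=
  (\int[lebesgue_tuple R d]_(y in [set y | (r <= enorm y)%R]) (nu y)%:E)%E.

End euclidean.

Section matuszewska.
Context (R : realType).
Implicit Types phi : R -> R.

Local Open Scope ereal_scope.

(* The indices are extended reals: -oo if no exponent is admissible, +oo if
   the admissible exponents are unbounded. Only the values of phi on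
   ]0, +oo[ matter. *)

Definition lower_index_zero phi : \bar R :=
  ereal_sup [set a%:E | a in [set a : R | exists A R0 : R,
    [/\ (0 < A)%R, (0 < R0)%R & forall r1 r2 : R,
      (0 < r1)%R -> (r1 < r2)%R -> (r2 < R0)%R ->
      (A * (r2 / r1) `^ a <= phi r2 / phi r1)%R]]].

Definition lower_index_infty phi : \bar R :=
  ereal_sup [set a%:E | a in [set a : R | exists A R0 : R,
    [/\ (0 < A)%R, (0 < R0)%R & forall r1 r2 : R,
      (R0 < r1)%R -> (r1 < r2)%R ->
      (A * (r2 / r1) `^ a <= phi r2 / phi r1)%R]]].

End matuszewska.

(* Main.v *)
(* Write [a > -d-1] for an admissible exponent in both scaling bounds, and let nu' be
   [nu] with the intermediate range R0 <= |x| <= R1 removed, where nothing is known about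
   the profile, and L' its tail function. Fix a large [lam] and put w(x) = L'(lam |x|). By translation
   and reflection, w(x) is the integral of nu'(x - y) over those y with
   |x - y| >= lam |x|, so |f(x)|^p <= 2^p (|f(x) - f(y)|^p + |f(y)|^p) and Tonelli
   bound the integral of |f|^p w by 2^p times the energy plus 2^p times the integral of
   |f|^p M, where M(y) is the integral of nu'(x - y) over those x with
   |x - y| >= lam |x|. Such x fill a set of volume of order (|y| / lam)^d, and scaling gives
   M <= C lam^-(2d + a) w with 2d + a > 0, so the last term is absorbed for [lam] large. It is
   finite once x is restricted to |x| >= delta: the same restriction then holds for y,
   so the absorption is uniform in delta. Scaling also yields
   L(r) <= C L'(lam r), which turns the weight w back into L. *)

From HB Require Import structures.
Require Import Defs.
From mathcomp Require Import all_boot all_order all_algebra.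
From mathcomp Require Import all_classical all_reals all_analysis.
From mathcomp Require Import measurable_realfun ring lra.

Import Order.TTheory GRing.Theory Num.Theory.
Import numFieldNormedType.Exports.

Local Open Scope classical_set_scope.
Local Open Scope ring_scope.
Local Open Scope ereal_scope.

(** * Invariance of Lebesgue measure on R^d *)

Section lebesgue_tuple.
Context (R : realType).
Local Notation mu := (@lebesgue_measure R).

(** The measure is built one coordinate at a time, so Tonelli peels off the first coordinate;
    inductions on the dimension rest on this. *)
Lemma ge0_integral_lebesgue_tupleS (n : nat) (g : Rvec R n.+1 -> \bar R) :
  measurable_fun setT g -> (forall x, 0 <= g x) ->
  \int[lebesgue_tuple R n.+1]_t g t =
  \int[mu]_x \int[lebesgue_tuple R n]_t g (tuple_cons (x, t)).
Proof.
move=> mg g0.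
pose c := @tuple_cons _ (measurableTypeR R) n.
have mc : measurable_fun setT c by exact: measurable_tuple_cons.
transitivity (\int[(mu \x lebesgue_tuple R n)%E]_z (g \o c) z).
  by rewrite -[RHS](ge0_integral_pushforward mc _ measurableT).
by rewrite fubini_tonelli1//; [exact: measurableT_comp|move=> x; exact: g0].
Qed.

(** Lebesgue measure is determined by its values on the intervals ]b, c], and the preimage [a - c, a
    - b[ has the same length. *)
Lemma lebesgue_measure_reflect (a : R) (A : set R) : measurable A ->
  pushforward mu ((fun y : R => a - y)%R : _ -> measurableTypeR R) A = mu A.
Proof.
move=> mA.
have mf : measurable_fun setT ((fun y : R => a - y)%R : measurableTypeR R -> measurableTypeR R).
  by apply: measurable_funB => //; exact: measurable_id.
pose mf_mixin := isMeasurableFun.Build _ _ _ _ _ mf.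
pose f : {mfun measurableTypeR R >-> measurableTypeR R} :=
  HB.pack (fun y : R => a - y)%R mf_mixin.
apply/esym.
apply: (@lebesgue_measure_unique R (pushforward mu f)) => //= _ [[b c]] _ <-.
rewrite /pushforward /f/=.
rewrite (_ : _ @^-1` _ = `[a - c, a - b[%classic)%R; last first.
  apply/seteqP; split => z /=; rewrite !in_itv/= => /andP[? ?].
    by apply/andP; split; lra.
  by apply/andP; split; lra.
rewrite !lebesgue_measure_itv/= !lte_fin.
rewrite ltrD2l ltrN2; case: ifP => // _.
by rewrite -!EFinB; congr (_%:E); ring.
Qed.

Lemma ge0_integral_reflect (a : R) (g : R -> \bar R) :
  measurable_fun setT (g : measurableTypeR R -> _) -> (forall x, 0 <= g x) ->
  \int[mu]_y g (a - y)%R = \int[mu]_y g y.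
Proof.
move=> mg g0.
have mf : measurable_fun setT ((fun y : R => a - y)%R : measurableTypeR R -> measurableTypeR R).
  by apply: measurable_funB => //; exact: measurable_id.
rewrite -[LHS](ge0_integral_pushforward mf _ measurableT)//.
apply: eq_measure_integral => A mA _; exact: lebesgue_measure_reflect.
Qed.

Lemma measurable_tuple_sub (d : nat) :
  measurable_fun setT (fun z : Rvec R d * Rvec R d => tuple_sub z.1 z.2).
Proof.
apply/measurable_fun_tnthP => i /=.
rewrite (_ : _ \o _ = fun z => (tnth z.1 i : R) - tnth z.2 i)%R; last first.
  by apply/funext => z /=; rewrite tnth_mktuple.
apply: measurable_funB.
  exact: (measurableT_comp (measurable_tnth i) measurable_fst).
exact: (measurableT_comp (measurable_tnth i) measurable_snd).
Qed.

Lemma measurable_tuple_subr (d : nat) (x : Rvec R d) :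
  measurable_fun setT (tuple_sub x).
Proof.
exact: (measurable_fun_pair2 x (measurable_tuple_sub d)).
Qed.

Lemma measurable_enorm (d : nat) : measurable_fun setT (@enorm R d).
Proof.
rewrite /enorm; apply: measurableT_comp.
  by apply: continuous_measurable_fun; exact: sqrt_continuous.
apply: measurable_sum => i; apply: measurable_funX.
exact: measurable_tnth.
Qed.

Lemma tuple_sub_cons (n : nat) (a b : R) (x y : Rvec R n) :
  tuple_sub (tuple_cons (a, x)) (tuple_cons (b, y)) =
  tuple_cons ((a - b)%R : measurableTypeR R, tuple_sub x y).
Proof.
apply: eq_from_tnth => i; rewrite tnth_mktuple.
by case: (unliftP ord0 i) => [j ->|->]; rewrite ?tnthS ?tnth0 ?tnth_mktuple.
Qed.

(** Induction on the dimension, reflecting one coordinate at a time. It later recentres tail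
    integrals at an arbitrary point. *)
Lemma ge0_integral_tuple_sub (d : nat) (x : Rvec R d) (g : Rvec R d -> \bar R) :
  measurable_fun setT g -> (forall y, 0 <= g y) ->
  \int[lebesgue_tuple R d]_y g (tuple_sub x y) =
  \int[lebesgue_tuple R d]_y g y.
Proof.
elim: d => [|n IH] in x g * => mg g0.
  by apply: eq_integral => y _; congr g; rewrite [LHS]tuple0 [RHS]tuple0.
have mgc a : measurable_fun setT (fun t : Rvec R n => g (tuple_cons (a, t))).
  exact: (measurable_fun_pair2 a (measurableT_comp mg (@measurable_tuple_cons _ _ n))).
rewrite !ge0_integral_lebesgue_tupleS//; last first.
  exact: (measurableT_comp mg (measurable_tuple_subr _ x)).
have -> : x = tuple_cons (thead x, [tuple of behead x]).
  by rewrite {1}(tuple_eta x).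
under eq_integral do under eq_integral do rewrite tuple_sub_cons.
rewrite /=.
under eq_integral.
  move=> y _; rewrite (IH _ (fun t => g (tuple_cons ((thead x - y)%R : measurableTypeR R, t))))//.
  over.
rewrite (ge0_integral_reflect _ (fun y => \int[lebesgue_tuple R n]_t g (tuple_cons (y, t))))//.
  apply: (measurable_fun_fubini_tonelli_F (m2 := lebesgue_tuple R n) (g \o @tuple_cons _ _ n)).
    exact: measurableT_comp (@measurable_tuple_cons _ _ n).
  by move=> z; exact: g0.
by move=> y; exact: integral_ge0.
Qed.

End lebesgue_tuple.

(** * Euclidean norm and cubes *)

Section enorm.
Context (R : realType) (d : nat).
Implicit Types (x y a b c : Rvec R d) (r : R).

Lemma enorm_ge0 x : (0 <= enorm x)%R.
Proof. exact: sqrtr_ge0. Qed.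

Lemma sqr_enorm x : (enorm x ^+ 2 = \sum_(i < d) (tnth x i : R) ^+ 2)%R.
Proof. by rewrite sqr_sqrtr// sumr_ge0// => i _; exact: sqr_ge0. Qed.

Lemma enorm_leP x r : (0 <= r)%R ->
  (enorm x <= r)%R = (\sum_(i < d) (tnth x i : R) ^+ 2 <= r ^+ 2)%R.
Proof. by move=> r0; rewrite -sqr_enorm ler_pXn2r// nnegrE enorm_ge0. Qed.

Lemma tnth_le_enorm x i : (`|tnth x i : R| <= enorm x)%R.
Proof.
rewrite -(@ler_pXn2r _ 2)// ?nnegrE ?enorm_ge0 ?normr_ge0//.
rewrite sqr_enorm real_normK ?num_real// (bigD1 i)//= lerDl.
by rewrite sumr_ge0// => j _; exact: sqr_ge0.
Qed.

Lemma enorm_le_sup x r : (forall i, `|tnth x i : R| <= r)%R ->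
  (enorm x <= d%:R * r)%R.
Proof.
move=> xr; have [d0|d0] := posnP d.
  have -> : (d%:R = 0 :> R)%R by rewrite d0.
  rewrite mul0r /enorm big1 ?sqrtr0// => i.
  by have := ltn_ord i; rewrite [X in (_ < X)%N]d0.
have r0 : (0 <= r)%R by exact: le_trans (xr (Ordinal d0)).
rewrite enorm_leP ?mulr_ge0// (@le_trans _ _ (\sum_(i < d) r ^+ 2)%R)//.
  apply: ler_sum => i _; rewrite -[leLHS]real_normK ?num_real//.
  by rewrite ler_pXn2r// nnegrE.
rewrite sumr_const card_ord -[leLHS]mulr_natl exprMn ler_wpM2r ?sqr_ge0//.
by rewrite -natrX ler_nat -[leqLHS]expn1 leq_pexp2l.
Qed.

(** Coordinatewise (v + w)^2 <= 2 (v^2 + w^2). The extra factor 2 only affects constants, and the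
    coordinatewise hypothesis serves both inequalities below. *)
Lemma enorm_quasi_triangle a b c :
  (forall i, `|tnth a i : R| <= `|tnth b i : R| + `|tnth c i : R|)%R ->
  (enorm a <= 2 * (enorm b + enorm c))%R.
Proof.
move=> abc; have b0 := enorm_ge0 b; have c0 := enorm_ge0 c.
rewrite enorm_leP; last by lra.
apply: (@le_trans _ _ (2 * (enorm b ^+ 2 + enorm c ^+ 2)))%R; last by nra.
rewrite !sqr_enorm -big_split/= mulr_sumr; apply: ler_sum => i _.
have := abc i; move: (tnth a i : R) (tnth b i : R) (tnth c i : R) => u v w uvw.
rewrite -(real_normK (num_real u)) -(real_normK (num_real v)) -(real_normK (num_real w)).
have := normr_ge0 u; have := normr_ge0 v; have := normr_ge0 w.
move: `|u|%R `|v|%R `|w|%R uvw => {}u {}v {}w *.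
have : (0 <= (v - w) ^+ 2)%R by exact: sqr_ge0.
by nra.
Qed.

Lemma enorm_sub_le x y : (enorm (tuple_sub x y) <= 2 * (enorm x + enorm y))%R.
Proof.
by apply: enorm_quasi_triangle => i; rewrite tnth_mktuple; exact: ler_normB.
Qed.

Lemma enorm_le_subr x y : (enorm y <= 2 * (enorm (tuple_sub x y) + enorm x))%R.
Proof.
apply: enorm_quasi_triangle => i; rewrite tnth_mktuple.
rewrite -[X in (`|X| <= _)%R](_ : - ((tnth x i : R) - tnth y i) + tnth x i = _)%R;
  last by lra.
by rewrite -[X in (_ <= X + _)%R]normrN; exact: ler_normD.
Qed.

(** Closed cubes stand in for balls and annuli: their volume is a power of the side length, and
    norms on them are controlled up to factors depending on d. *)
Definition box r1 r2 : set (Rvec R d) :=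
  [set x | forall i, (r1 <= (tnth x i : R) <= r2)%R].

Lemma boxE r1 r2 : box r1 r2 = [set x : Rvec R d | forall i, `[r1, r2]%classic (tnth x i : R)].
Proof. by apply/seteqP; split => x /= + i => /(_ i); rewrite in_itv/=. Qed.

Lemma measurable_box r1 r2 : measurable (box r1 r2).
Proof.
rewrite (_ : box _ _ = \bigcap_(i in setT)
    ((fun x : Rvec R d => tnth x i) @^-1` `[r1, r2]%classic)).
  apply: fin_bigcap_measurable => // i _.
  by rewrite -[X in measurable X]setTI; apply: measurable_tnth.
by rewrite boxE; apply/seteqP; split => x /= => [+ i _|+ i]; exact.
Qed.

Lemma lebesgue_tuple_cube r1 r2 : (r1 <= r2)%R ->
  lebesgue_tuple R d (box r1 r2) = ((r2 - r1) ^+ d)%:E.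
Proof.
move=> r12; rewrite boxE (@lebesgue_tuple_box R d (fun=> `[r1, r2]%classic));
  last by move=> i; exact: measurable_itv.
under eq_bigr do rewrite lebesgue_measure_itv/=.
rewrite -[in RHS](card_ord d) -prodr_const -prodEFin; apply: eq_bigr => i _.
by rewrite lte_fin lt_neqAle r12 andbT; case: eqP => [->|//]; rewrite subrr.
Qed.

(** The origin is a cube of side 0, of volume 0^d = 0 since d > 0. This allows discarding the point
    where L may be infinite. *)
Lemma enorm0_null (A : set (Rvec R d)) : (0 < d)%N -> measurable A ->
  A `<=` [set x | enorm x = 0%R] -> lebesgue_tuple R d A = 0.
Proof.
move=> d0 mA A0; apply/eqP; rewrite eq_le measure_ge0 andbT.
apply: (@le_trans _ _ (lebesgue_tuple R d (box 0 0))).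
  apply: le_measure; rewrite ?inE//; first exact: measurable_box.
  move=> x /A0 /= x0 i; have := tnth_le_enorm x i; rewrite x0 normr_le0 => /eqP ->.
  by rewrite lexx.
by rewrite lebesgue_tuple_cube// subrr expr0n gtn_eqF.
Qed.

Lemma box_enorm r x : (0 <= r)%R -> (enorm x <= r)%R -> box (- r) r x.
Proof.
by move=> r0 xr i; have := le_trans (tnth_le_enorm x i) xr; rewrite ler_norml.
Qed.

End enorm.

(** * Scaling of the profile *)

Section scaling.
Context (R : realType) (phi : R -> R).
Hypothesis phi_gt0 : forall r : R, (0 < r)%R -> (0 < phi r)%R.
Local Open Scope ring_scope.

(* Across the gap, [phi s] and [phi t] are compared through [phi R0] and [phi R1]. *)
Lemma global_scaling (b : R) : b < 0 ->
  (b%:E < lower_index_zero phi)%E -> (b%:E < lower_index_infty phi)%E ->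
  exists a A R0 R1 : R, [/\ b < a, a <= 0, 0 < A & [/\ 0 < R0, R0 <= R1 &
    forall s t, 0 < s -> s < t -> (s < R0) || (R1 < s) ->
      (t < R0) || (R1 < t) -> phi s * A * (t / s) `^ a <= phi t]].
Proof.
move=> b0 /ereal_sup_gt[_ [a0 [A0 [r0 [A0_gt0 r0_gt0 H0]]] <-]]; rewrite lte_fin => ba0.
move=> /ereal_sup_gt[_ [a1 [A1 [r1 [A1_gt0 r1_gt0 H1]]] <-]]; rewrite lte_fin => ba1.
(* Lowering an exponent is harmless because t / s > 1. Capping at 0 keeps a > b, as b < 0, and makes
   u^a nonincreasing in u. *)
pose a := Num.min (Num.min a0 a1) 0.
have a_le0 : a <= 0 by rewrite /a ge_min lexx orbT.
have a_lea0 : a <= a0 by rewrite /a !ge_min lexx.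
have a_lea1 : a <= a1 by rewrite /a !ge_min lexx orbT.
have weaken s t c B : 0 < s -> s < t -> a <= c -> 0 < B ->
    B * (t / s) `^ c <= phi t / phi s -> phi s * B * (t / s) `^ a <= phi t.
  move=> s0 st ac B0; have phis := phi_gt0 _ s0.
  rewrite ler_pdivlMr//; apply: le_trans.
  rewrite mulrC [phi s * B]mulrC mulrA ler_wpM2r//; first exact: ltW.
  rewrite mulrC ler_wpM2l ?(ltW B0)// ler_powR//.
  by rewrite ler_pdivlMr// mul1r ltW.
(* With R0 < r0 and R1 > r1, the endpoints R0 and R1 may themselves be used in the two strict
   scaling ranges. *)
pose R0 := r0 / 2; pose R1 := 2 * r1 + R0.
have R0_gt0 : 0 < R0 by rewrite divr_gt0.
have R01 : R0 <= R1 by rewrite /R1; lra.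
have R1_gt0 : 0 < R1 by exact: lt_le_trans R01.
(* Chaining s to R0, R0 to R1 and R1 to t: the middle link is the ratio of the two profile values,
   and (R0 / R1)^a cancels the middle factor of (t / s)^a. *)
pose A2 := A0 * A1 * (phi R1 / phi R0) * (R0 / R1) `^ a.
have A2_gt0 : 0 < A2 by rewrite /A2 !mulr_gt0 ?powR_gt0 ?divr_gt0 ?invr_gt0 ?phi_gt0.
pose A := Num.min (Num.min A0 A1) A2.
have A_gt0 : 0 < A by rewrite /A !lt_min A0_gt0 A1_gt0 A2_gt0.
have wA s t B : 0 < s -> A <= B -> phi s * B * (t / s) `^ a <= phi t ->
    phi s * A * (t / s) `^ a <= phi t.
  move=> s0 AB; apply: le_trans; rewrite ler_wpM2r ?powR_ge0//.
  by rewrite ler_wpM2l// ltW// phi_gt0.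
have zero s t : 0 < s -> s < t -> t <= R0 -> phi s * A0 * (t / s) `^ a <= phi t.
  move=> s0 st tR; apply: (weaken _ _ a0) => //; apply: H0 => //.
  by move: tR; rewrite /R0; lra.
have infty s t : R1 <= s -> s < t -> phi s * A1 * (t / s) `^ a <= phi t.
  move=> Rs st; apply: (weaken _ _ a1) => //; first by rewrite (lt_le_trans _ Rs).
  by apply: H1 => //; rewrite (lt_le_trans _ Rs)// /R1; lra.
exists a, A, R0, R1; split => //; first by rewrite /a !lt_min ba0 ba1.
split => // s t s0 st sS tS.
have t0 : 0 < t by exact: lt_trans st.
case/orP : sS => sS; last first.
  apply: (wA _ _ A1) => //; first by rewrite /A !ge_min lexx orbT.
  by apply: infty => //; exact: ltW.
case/orP : tS => tS.
  apply: (wA _ _ A0) => //; first by rewrite /A !ge_min lexx.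
  by apply: zero => //; exact: ltW.
apply: (wA _ _ A2) => //; first by rewrite /A !ge_min lexx orbT.
apply: le_trans (infty R1 t (lexx _) tS).
have -> : (t / s) `^ a = (t / R1) `^ a * (R1 / R0) `^ a * (R0 / s) `^ a.
  rewrite -!powRM ?mulr_ge0 ?invr_ge0 ?ltW//; congr (_ `^ _).
  by field; rewrite !gt_eqF.
have e : (R0 / R1) `^ a * (R1 / R0) `^ a = 1.
  rewrite -powRM ?divr_ge0 ?ltW// (_ : _ * _ = 1) ?powR1//.
  by field; rewrite !gt_eqF.
rewrite [leLHS](_ : _ = (phi s * A0 * (R0 / s) `^ a) * (phi R1 / phi R0 * A1 * (t / R1) `^ a) *
   ((R0 / R1) `^ a * (R1 / R0) `^ a)); last by rewrite /A2; ring.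
rewrite e mulr1.
apply: (@le_trans _ _ (phi R0 * (phi R1 / phi R0 * A1 * (t / R1) `^ a))).
  rewrite ler_wpM2r//; last exact: zero.
  by rewrite !mulr_ge0 ?invr_ge0 ?powR_ge0// ltW// phi_gt0.
rewrite le_eqVlt; apply/orP; left; apply/eqP.
by field; rewrite gt_eqF// phi_gt0.
Qed.

End scaling.

(** * Tail integrals *)

Lemma le0_ler_powR (R : realType) (a x y : R) : (a <= 0)%R -> (0 < x)%R -> (x <= y)%R ->
  (y `^ a <= x `^ a)%R.
Proof.
move=> a0 x0 xy; have y0 : (0 < y)%R by exact: lt_le_trans xy.
rewrite -[a]opprK !(powRN _ (- a)) lef_pV2 ?posrE ?powR_gt0//.
by rewrite ge0_ler_powR ?oppr_ge0 ?nnegrE// ltW.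
Qed.

Lemma measurable_natr_bool d (T : measurableType d) (R : realType) (b : T -> bool) :
  measurable_fun setT b -> measurable_fun setT (fun x => (b x)%:R%R : R).
Proof.
move=> mb; rewrite (_ : (fun _ => _) = fun x => if b x then 1%R else 0%R); last first.
  by apply/funext => x; case: (b x).
exact: measurable_fun_ifT.
Qed.

Lemma ge0_integral_le_indic d (T : measurableType d) (R : realType)
    (mu : {measure set T -> \bar R}) (B : set T) (m : R) (f : T -> R) :
  measurable B -> measurable_fun setT f ->
  (forall x, 0 <= f x)%R -> (forall x, f x <= m * \1_B x)%R -> (0 <= m)%R ->
  \int[mu]_x (f x)%:E <= m%:E * mu B.
Proof.
move=> mB mf f0 fm m0; rewrite -[B in mu B]setIT -integral_indic//.
rewrite -ge0_integralZl//.
- apply: ge0_le_integral => //.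
  + by move=> x _; rewrite lee_fin.
  + exact/measurable_EFinP.
  + by apply/measurable_funeM/measurable_EFinP.
  + by move=> x _; rewrite -EFinM lee_fin.
exact/measurable_EFinP.
Qed.

Section tail_integral.
Context (R : realType) (d : nat) (nu : Rvec R d -> R).
Hypothesis nu_meas : measurable_fun [set: Rvec R d] nu.
Hypothesis nu_ge0 : forall x, (0 <= nu x)%R.

(** With the constraint moved into the integrand, the tail is a section integral of a function of r
    and y, to which Tonelli applies. *)
Lemma tail_integralE r : tail_integral nu r =
  \int[lebesgue_tuple R d]_y (nu y * (r <= enorm y)%R%:R)%:E.
Proof.
rewrite /tail_integral integral_mkcond; apply: eq_integral => y _.
rewrite patchE; case: (leP r (enorm y)) => ry.
  by rewrite mem_set// mulr1.
by rewrite memNset ?mulr0//=; apply/negP; rewrite -ltNge.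
Qed.

Lemma measurable_enorm_ge r : measurable_fun setT (fun y : Rvec R d => (r <= enorm y)%R).
Proof. by apply: measurable_fun_ler => //; exact: measurable_enorm. Qed.

Lemma measurable_tail_integrand r :
  measurable_fun setT (fun y => nu y * (r <= enorm y)%R%:R)%R.
Proof.
by apply: measurable_funM => //; apply: measurable_natr_bool; exact: measurable_enorm_ge.
Qed.

Lemma tail_integral_ge0 r : 0 <= tail_integral nu r.
Proof. by apply: integral_ge0 => y _; rewrite lee_fin. Qed.

Lemma le_tail_integral r1 r2 : (r1 <= r2)%R -> tail_integral nu r2 <= tail_integral nu r1.
Proof.
move=> r12; apply: ge0_subset_integral => //.
- by rewrite -[X in measurable X]setTI; exact: measurable_enorm_ge.
- by rewrite -[X in measurable X]setTI; exact: measurable_enorm_ge.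
- by apply/measurable_EFinP; exact: measurable_funTS.
- by move=> y _; rewrite lee_fin.
- by move=> y /=; exact: le_trans.
Qed.

Lemma measurable_tail_integral d' (T : measurableType d') (g : T -> R) :
  measurable_fun setT g -> measurable_fun setT (fun x => tail_integral nu (g x)).
Proof.
move=> mg; rewrite (_ : (fun _ => _) = fun x => \int[lebesgue_tuple R d]_y
    (nu y * (g x <= enorm y)%R%:R)%:E); last first.
  by apply/funext => x; exact: tail_integralE.
apply: (measurable_fun_fubini_tonelli_F (m2 := lebesgue_tuple R d)
  (fun z => (nu z.2 * (g z.1 <= enorm z.2)%R%:R)%:E)).
  apply/measurable_EFinP; apply: measurable_funM.
    exact: measurableT_comp measurable_snd.
  apply: measurable_natr_bool; apply: measurable_fun_ler.
    exact: (measurableT_comp mg measurable_fst).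
  exact: (measurableT_comp (measurable_enorm R d) measurable_snd).
by move=> z; rewrite lee_fin mulr_ge0.
Qed.

(** On |x| >= r the weight min(1, |x|^p) is at least m = min(1, r^p) > 0, so there [nu] is at most
    1/m times the integrand assumed integrable. *)
Lemma levy_tail_fin (p r : R) : (0 <= p)%R -> (0 < r)%R ->
  \int[lebesgue_tuple R d]_x (Num.min 1 (enorm x `^ p) * nu x)%:E < +oo ->
  tail_integral nu r < +oo.
Proof.
move=> p0 r0 levy; pose m := Num.min 1%R (r `^ p)%R.
have m0 : (0 < m)%R by rewrite lt_min ltr01 powR_gt0.
have mlevy : measurable_fun [set: Rvec R d] (fun x => (Num.min 1 (enorm x `^ p) * nu x)%R).
  apply: measurable_funM => //; apply: measurable_minr => //.
  exact: (measurableT_comp (measurable_powR p) (measurable_enorm R d)).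
have min0 x : (0 <= Num.min 1 (enorm x `^ p))%R by rewrite le_min ler01 powR_ge0.
apply: (@le_lt_trans _ _ (m^-1%:E * \int[lebesgue_tuple R d]_x
    (Num.min 1 (enorm x `^ p) * nu x)%:E)); last first.
  by rewrite lte_mul_pinfty// lee_fin invr_ge0 ltW.
rewrite tail_integralE -ge0_integralZl//.
- apply: ge0_le_integral => //.
  + by move=> x _; rewrite lee_fin mulr_ge0.
  + by apply/measurable_EFinP; exact: measurable_tail_integrand.
  + by apply/measurable_funeM/measurable_EFinP.
  + move=> x _; rewrite -EFinM lee_fin.
    case: (leP r (enorm x)) => rx; last by rewrite mulr0 !mulr_ge0 ?invr_ge0// ltW.
    rewrite mulr1 mulrA ler_peMl// mulrC ler_pdivlMr// mul1r le_min ge_min lexx/=.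
    rewrite ge_min; apply/orP; right.
    by rewrite ge0_ler_powR// nnegrE// ?enorm_ge0// ltW.
- exact/measurable_EFinP.
- by move=> x _; rewrite lee_fin mulr_ge0.
- by rewrite lee_fin invr_ge0 ltW.
Qed.

End tail_integral.

(** * Estimates for a kernel with scaling outside a gap *)

Lemma powR_natD (R : realType) (x a : R) n : (0 < x)%R ->
  (x `^ (n%:R + a) = x ^+ n * x `^ a)%R.
Proof.
move=> x0; rewrite powRD ?powR_mulrn// ?ltW//.
by apply/implyP => _; rewrite gt_eqF.
Qed.

Section radial_kernel.
Context (R : realType) (d : nat) (nu : Rvec R d -> R) (phi : R -> R).
Hypothesis d_gt0 : (0 < d)%N.
Hypothesis nu_meas : measurable_fun [set: Rvec R d] nu.
Hypothesis nu_ge0 : forall x, (0 <= nu x)%R.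
Hypothesis nu_radial : forall x, nu x = phi (enorm x).
Hypothesis phi_gt0 : forall r : R, (0 < r)%R -> (0 < phi r)%R.
Variables (a A R0 R1 : R).
Hypothesis a_gt : (- d%:R - 1 < a)%R.
Hypothesis a_le0 : (a <= 0)%R.
Hypothesis A_gt0 : (0 < A)%R.
Hypothesis R0_gt0 : (0 < R0)%R.
Hypothesis R01 : (R0 <= R1)%R.

(* The profile is only controlled off the gap: on it, [phi] may be arbitrarily large or
   small, so it is discarded from the kernel. *)
Definition off_gap (s : R) := ((s < R0) || (R1 < s))%R.

Hypothesis phi_scaling : forall s t, (0 < s)%R -> (s < t)%R -> off_gap s -> off_gap t ->
  (phi s * A * (t / s) `^ a <= phi t)%R.

Definition nu_off (x : Rvec R d) : R := (nu x * (off_gap (enorm x))%:R)%R.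

Let dR_ge1 : (1 <= d%:R :> R)%R.
Proof. by rewrite ler1n. Qed.

Lemma nu_off_ge0 x : (0 <= nu_off x)%R.
Proof. exact: mulr_ge0. Qed.

Lemma nu_off_le x : (nu_off x <= nu x)%R.
Proof. by rewrite /nu_off; case: off_gap; rewrite ?mulr1 ?mulr0. Qed.

Lemma measurable_nu_off : measurable_fun [set: Rvec R d] nu_off.
Proof.
apply: measurable_funM => //; apply: measurable_natr_bool.
have mE := @measurable_enorm R d.
by apply: measurable_or; apply: measurable_fun_ltr.
Qed.

(* Integrate the scaling bound over the cube [t, 2t]^d, with [t] comparable to [r] and
   chosen so that the cube avoids the gap. *)
Lemma tail_off_lower : exists2 c : R, (0 < c)%R &
  forall s r, (0 < s)%R -> (s <= r)%R -> off_gap s ->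
    (c * phi s * s `^ (- a) * r `^ (d%:R + a))%:E <= tail_integral nu_off r.
Proof.
have R1_gt0 : (0 < R1)%R by exact: lt_le_trans R01.
(* If 4 d r >= R0, this factor gives K r >= 2 R1, beyond the gap. *)
pose K : R := (8 * d%:R * (R1 / R0))%R.
have q1 : (1 <= R1 / R0)%R by rewrite ler_pdivlMr// mul1r.
have K8 : (8 <= K)%R.
  rewrite /K -mulrA -[leLHS]mulr1 ler_wpM2l// -[leLHS]mulr1.
  by rewrite ler_pM.
(* Only the dilation factors 2 and K occur below. The sign of d + a is not known, so neither power
   dominates in general. *)
pose c0 := Num.min (2 `^ (d%:R + a))%R (K `^ (d%:R + a))%R.
have c0_gt0 : (0 < c0)%R by rewrite lt_min !powR_gt0// (lt_le_trans _ K8).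
exists (A * (2 * d%:R) `^ a * c0)%R.
  by rewrite !mulr_gt0// powR_gt0// mulr_gt0// ltr0n.
move=> s r s_gt0 sr sS; have r_gt0 : (0 < r)%R by exact: lt_le_trans sr.
(* For 4 d r < R0 the factor 2 keeps the whole cube below R0; otherwise K pushes it above R1. *)
have [k [k2 kc0 kS]] : exists k : R, [/\ (2 <= k)%R, (c0 <= k `^ (d%:R + a))%R &
    forall t, (k * r <= t)%R -> (t <= 2 * d%:R * (k * r))%R -> off_gap t].
  have [small|large] := ltP (4 * d%:R * r)%R R0.
    exists 2%R; split => //; first by rewrite /c0 ge_min lexx.
    by move=> t _ tr; apply/orP; left; apply: le_lt_trans tr _; lra.
  exists K; split => //; first by lra.
    by rewrite /c0 ge_min lexx orbT.
  move=> t tr _; apply/orP; right; apply: lt_le_trans tr.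
  apply: (@lt_le_trans _ _ (2 * R1)%R); first by lra.
  rewrite /K (_ : _ * r = 2 * (4 * d%:R * r) * (R1 / R0))%R; last by ring.
  rewrite (_ : 2 * R1 = 2 * R0 * (R1 / R0))%R; last by field; rewrite gt_eqF.
  by rewrite ler_wpM2r//; lra.
set t := (k * r)%R in kS; have tE : t = (k * r)%R by []; clearbody t.
have t_gt0 : (0 < t)%R by rewrite tE mulr_gt0// (lt_le_trans _ k2).
have st : (s < t)%R by apply: le_lt_trans sr _; rewrite tE; nra.
have rt : (r <= t)%R by rewrite tE; nra.
pose B := @box R d t (2 * t).
have mB : measurable B by exact: measurable_box.
have B_enorm z : B z -> (t <= enorm z <= 2 * d%:R * t)%R.
  move=> Bz; apply/andP; split.
    have /andP[tz _] := Bz (Ordinal d_gt0).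
    by apply: (le_trans tz); apply: le_trans (tnth_le_enorm _ _ z (Ordinal d_gt0)); exact: ler_norm.
  rewrite (_ : 2 * d%:R * t = d%:R * (2 * t))%R; last by ring.
  apply: enorm_le_sup => i; have /andP[tz zt] := Bz i.
  by rewrite ger0_norm// (le_trans _ tz)// ltW.
(* Norms on the cube are at most 2 d t, and a <= 0 makes the scaling factor smallest at that
   bound. *)
pose m := (phi s * A * ((2 * d%:R * t) / s) `^ a)%R.
have m_ge0 : (0 <= m)%R by rewrite !mulr_ge0 ?powR_ge0// ltW// phi_gt0.
have B_lower z : B z -> (m <= nu_off z)%R.
  move=> /B_enorm /andP[tz zt]; have zS := kS _ tz zt.
  have z_gt0 : (0 < enorm z)%R by exact: lt_le_trans tz.
  rewrite /nu_off zS mulr1 nu_radial.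
  apply: le_trans (phi_scaling s (enorm z) s_gt0 (lt_le_trans st tz) sS zS).
  rewrite /m ler_wpM2l//; first by rewrite ltW// mulr_gt0// phi_gt0.
  apply: le0_ler_powR => //; first by rewrite divr_gt0.
  by rewrite ler_pM2r ?invr_gt0.
apply: (@le_trans _ _ (m%:E * lebesgue_tuple R d B)).
  rewrite lebesgue_tuple_cube; last by lra.
  rewrite -EFinM lee_fin (_ : 2 * t - t = t)%R; last by ring.
  rewrite /m -(powR_mulrn _ (ltW t_gt0)).
  have -> : ((2 * d%:R * t / s) `^ a = (2 * d%:R) `^ a * t `^ a * s `^ (- a))%R.
    have ds : (0 <= 2 * d%:R :> R)%R by rewrite mulr_ge0.
    rewrite powRM ?mulr_ge0 ?invr_ge0 ?(ltW s_gt0) ?(ltW t_gt0)//.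
    rewrite powRM ?(ltW t_gt0)//; congr (_ * _)%R.
    by rewrite -powR_inv1 ?ltW// -powRrM mulN1r.
  have -> : (phi s * A * ((2 * d%:R) `^ a * t `^ a * s `^ (- a)) * t `^ d%:R =
    A * (2 * d%:R) `^ a * phi s * s `^ (- a) * t `^ (d%:R + a))%R.
    rewrite powRD; first by ring.
    by apply/implyP => _; rewrite gt_eqF.
  have -> : (t `^ (d%:R + a) = k `^ (d%:R + a) * r `^ (d%:R + a))%R.
    by rewrite tE powRM// ?ltW// (lt_le_trans _ k2).
  rewrite (_ : _ * c0 * phi s * _ * _ =
    A * (2 * d%:R) `^ a * phi s * s `^ (- a) * (c0 * r `^ (d%:R + a)))%R; last by ring.
  rewrite ler_wpM2l//; last by rewrite ler_wpM2r// powR_ge0.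
  by rewrite !mulr_ge0 ?powR_ge0// ltW// phi_gt0.
have mO := measurable_nu_off.
rewrite -integral_cst//; apply: (@le_trans _ _ (\int[lebesgue_tuple R d]_(z in B) (nu_off z)%:E)).
  apply: ge0_le_integral => //.
  by apply/measurable_EFinP; exact: measurable_funTS.
apply: ge0_subset_integral => //.
- by rewrite -[X in measurable X]setTI; exact: measurable_enorm_ge.
- by apply/measurable_EFinP; exact: measurable_funTS.
- by move=> z _; rewrite lee_fin nu_off_ge0.
- by move=> z /B_enorm /andP[tz _] /=; exact: le_trans tz.
Qed.

(** The preceding bound solved for phi s: the tail at r controls the profile at all smaller radii
    off the gap. The tail enters through its finite value w, so that the division takes place in the
    reals. *)
Lemma tail_off_upper : exists2 C : R, (0 < C)%R & forall s r w,
  (0 < s)%R -> (s <= r)%R -> off_gap s -> tail_integral nu_off r = w%:E ->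
  (phi s <= C * w * s `^ a / (r ^+ d * r `^ a))%R.
Proof.
have [c c0 H] := tail_off_lower; exists c^-1%R; first by rewrite invr_gt0.
move=> s r w s0 sr sS wE; have r0 : (0 < r)%R by exact: lt_le_trans sr.
have := H s r s0 sr sS; rewrite wE lee_fin powR_natD// powRN => h.
have sa : (0 < s `^ a)%R by exact: powR_gt0.
have ra : (0 < r `^ a)%R by exact: powR_gt0.
have rd : (0 < r ^+ d)%R by exact: exprn_gt0.
rewrite ler_pdivlMr ?mulr_gt0// -(ler_pM2l c0).
rewrite (_ : c * (c^-1 * w * s `^ a) = w * s `^ a)%R; last by field; rewrite gt_eqF.
rewrite -ler_pdivrMr//; apply: le_trans h.
by rewrite le_eqVlt; apply/orP; left; apply/eqP; field; rewrite gt_eqF.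
Qed.

(* The integrand lives on |x| <= 4 |y| / lam, where |x - y| is comparable to |y|; this gives
   a constant times lam^-(2d + a), and 2d + a > d - 1 >= 0. *)
Lemma near_mass (theta : R) : (0 < theta)%R -> exists2 lam : R, (4 <= lam)%R &
  forall y, (0 < enorm y)%R ->
    \int[lebesgue_tuple R d]_x
      (nu_off (tuple_sub x y) * (lam * enorm x <= enorm (tuple_sub x y))%R%:R)%:E <=
    theta%:E * tail_integral nu_off (lam * enorm y).
Proof.
move=> theta0; have [C C0 H] := tail_off_upper.
pose e : R := (d%:R + (d%:R + a))%R.
have e0 : (0 < e)%R by move: a_gt dR_ge1; rewrite /e; move: (d%:R : R)%R => D; lra.
(* Collected constants: C from the profile bound, 8^d from a cube of side 8 r / [lam], and (1/4)^a
   from |x - y| >= r / 4. *)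
pose D : R := (C * 8 ^+ d * 4^-1 `^ a)%R.
have D0 : (0 < D)%R by rewrite !mulr_gt0// ?exprn_gt0// powR_gt0 ?invr_gt0.
(* The second entry gives [lam]^e >= D / [theta]. One factor [lam]^d comes from the volume, the
   remaining [lam]^(d + a) from the profile bound at radius [lam] r. *)
pose lam := Num.max 4%R ((D / theta) `^ e^-1)%R.
have lam4 : (4 <= lam)%R by rewrite le_max lexx.
have lam0 : (0 < lam)%R by exact: lt_le_trans lam4.
have lamD : (D / (lam ^+ d * lam ^+ d * lam `^ a) <= theta)%R.
  rewrite -mulrA -powR_natD// -powR_natD// -/e.
  rewrite ler_pdivrMr ?powR_gt0// mulrC -ler_pdivrMr//.
  rewrite -[leLHS]powRr1; last by rewrite ltW// divr_gt0.
  rewrite -(mulVf (lt0r_neq0 e0)) powRrM ge0_ler_powR// ?nnegrE ?powR_ge0//.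
  - exact: ltW.
  - exact: ltW.
  - by rewrite le_max lexx orbT.
clearbody lam; exists lam => // y; set r := enorm y => r0.
have lamr0 : (0 < lam * r)%R by rewrite mulr_gt0.
have := tail_integral_ge0 _ _ _ nu_off_ge0 (lam * r)%R.
case Ew: (tail_integral nu_off (lam * r)%R) => [w| |]// w0; last first.
  by rewrite gt0_muley ?lte_fin// leey.
rewrite lee_fin in w0.
pose rho := (4 * r / lam)%R.
have rho0 : (0 <= rho)%R by rewrite !mulr_ge0 ?invr_ge0// ltW.
pose m := (C * w * (r / 4) `^ a / ((lam * r) ^+ d * (lam * r) `^ a))%R.
have m0 : (0 <= m)%R.
  by rewrite !mulr_ge0 ?invr_ge0 ?mulr_ge0 ?powR_ge0 ?exprn_ge0// ltW.
have mk : measurable_fun [set: Rvec R d] (fun x => nu_off (tuple_sub x y) *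
    (lam * enorm x <= enorm (tuple_sub x y))%R%:R)%R.
  have msub : measurable_fun setT (fun x : Rvec R d => tuple_sub x y).
    exact: (measurable_fun_pair1 y (measurable_tuple_sub R d)).
  apply: measurable_funM; first exact: (measurableT_comp measurable_nu_off msub).
  apply: measurable_natr_bool; apply: measurable_fun_ler.
    by apply: measurable_funM => //; exact: measurable_enorm.
  exact: (measurableT_comp (measurable_enorm R d) msub).
apply: (@le_trans _ _ (m%:E * lebesgue_tuple R d (@box R d (- rho) rho))).
  apply: ge0_integral_le_indic => //; first exact: measurable_box.
    by move=> x; rewrite mulr_ge0 ?nu_off_ge0.
  move=> x; set s := enorm (tuple_sub x y).
  have := enorm_le_subr _ _ x y; rewrite -/s -/r => rs.
  have := enorm_sub_le _ _ x y; rewrite -/s -/r => sr.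
  have x0 := enorm_ge0 _ _ x.
  case: (leP (lam * enorm x)%R s) => xs; last by rewrite mulr0 mulr_ge0.
  (* Since |x| <= s / 4, the quasi-triangle inequalities give r <= 5 s / 2 and s <= s / 2 + 2 r.
     Hence also |x| <= s / [lam] <= 4 r / [lam]. *)
  have s4 : (r / 4 <= s)%R by nra.
  have s4r : (s <= 4 * r)%R by nra.
  have s0 : (0 < s)%R by apply: lt_le_trans s4; rewrite divr_gt0.
  rewrite indicE mem_set; last first.
    by apply: box_enorm => //; rewrite /rho ler_pdivlMr//; nra.
  rewrite !mulr1 /nu_off -/s; case sS : (off_gap s); last by rewrite mulr0.
  rewrite mulr1 nu_radial -/s; apply: le_trans (H s (lam * r)%R w s0 _ sS Ew) _.
    by apply: (le_trans s4r); rewrite ler_wpM2r// ltW.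
  rewrite /m ler_wpM2r ?invr_ge0 ?mulr_ge0 ?powR_ge0 ?exprn_ge0 ?(ltW lamr0)//.
  rewrite ler_wpM2l ?mulr_ge0 ?(ltW C0)//.
  by apply: le0_ler_powR => //; rewrite divr_gt0.
rewrite lebesgue_tuple_cube; last by rewrite -subr_ge0 opprK addr_ge0.
rewrite -!EFinM lee_fin.
apply: (@le_trans _ _ (D / (lam ^+ d * lam ^+ d * lam `^ a) * w)%R); last first.
  by rewrite ler_wpM2r.
rewrite (_ : rho - - rho = 8 * r / lam)%R; last by rewrite /rho; field; rewrite gt_eqF.
rewrite /m /D !exprMn exprVn !powRM ?invr_ge0 ?(ltW lam0) ?(ltW r0)//.
rewrite le_eqVlt; apply/orP; left; apply/eqP.
have ra : (0 < r `^ a)%R by exact: powR_gt0.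
have rd : (0 < r ^+ d)%R by exact: exprn_gt0.
have la : (0 < lam `^ a)%R by exact: powR_gt0.
have ld : (0 < lam ^+ d)%R by exact: exprn_gt0.
move: ra rd la ld; move: (r `^ a)%R (r ^+ d)%R (lam `^ a)%R (lam ^+ d)%R (4^-1 `^ a)%R (8 ^+ d)%R.
by move=> ? ? ? ? ? ? ? ? ? ?; field; rewrite !gt_eqF.
Qed.

(** The region |y| >= r splits into three: off the gap beyond [lam] r, off the gap below [lam] r,
    where the profile bound is integrated over a cube, and the gap, whose mass is at most the finite
    tail at R0. *)
Lemma tail_doubling (lam : R) : (1 <= lam)%R ->
  (forall r, (0 < r)%R -> tail_integral nu r < +oo) ->
  exists2 D : R, (0 < D)%R & forall r, (0 < r)%R ->
    tail_integral nu r <= D%:E * tail_integral nu_off (lam * r).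
Proof.
move=> lam1 tail_fin; have lam0 : (0 < lam)%R by exact: lt_le_trans lam1.
have [C C0 HC] := tail_off_upper; have [c c0 Hc] := tail_off_lower.
have R1_gt0 : (0 < R1)%R by exact: lt_le_trans R01.
have [M M0 ME] : exists2 M : R, (0 <= M)%R & tail_integral nu R0 = M%:E.
  have := tail_integral_ge0 _ _ _ nu_ge0 R0; have := tail_fin _ R0_gt0.
  by case: (tail_integral nu R0) => // M _ M0; exists M.
(* The radius R0 / 2 lies below the gap, so the lower tail bound makes the tail at [lam] R1 strictly
   positive. *)
have [c1 c10 Hc1] : exists2 c1 : R, (0 < c1)%R & c1%:E <= tail_integral nu_off (lam * R1).
  have h0 : (0 < R0 / 2)%R by rewrite divr_gt0.
  exists (c * phi (R0 / 2) * (R0 / 2) `^ (- a) * (lam * R1) `^ (d%:R + a))%R.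
    by rewrite !mulr_gt0// ?powR_gt0// ?mulr_gt0// phi_gt0.
  apply: Hc => //; first by have := R01; nra.
  by apply/orP; left; lra.
pose D2 := (C * 2 ^+ d / lam `^ a)%R.
have D20 : (0 < D2)%R by rewrite !mulr_gt0 ?invr_gt0 ?powR_gt0 ?exprn_gt0.
exists (1 + D2 + M / c1)%R; first by rewrite ltr_wpDr ?divr_ge0 ?(ltW c10)// addr_gt0.
move=> r r0; have lamr0 : (0 < lam * r)%R by rewrite mulr_gt0.
have := tail_integral_ge0 _ _ _ nu_off_ge0 (lam * r)%R.
case Ew: (tail_integral nu_off (lam * r)%R) => [w| |]// w0; last first.
  rewrite gt0_muley ?leey// lte_fin ltr_wpDr ?divr_ge0 ?(ltW c10)//.
  by rewrite addr_gt0.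
rewrite lee_fin in w0.
pose m := (C * w * r `^ a / ((lam * r) ^+ d * (lam * r) `^ a))%R.
have m0 : (0 <= m)%R.
  by rewrite !mulr_ge0 ?invr_ge0 ?mulr_ge0 ?powR_ge0 ?exprn_ge0// ltW.
pose B := @box R d (- (lam * r)) (lam * r).
have mB : measurable B by exact: measurable_box.
pose f1 y := (nu_off y * (lam * r <= enorm y)%R%:R)%R.
pose f2 y := (m * \1_B y)%R.
(* A gap point with |y| >= r forces r <= R1; recording this restricts the gap term to radii where
   the tail at [lam] r is bounded below. *)
pose f3 y := (nu y * (R0 <= enorm y)%R%:R * (r <= R1)%R%:R)%R.
have mf1 : measurable_fun setT f1.
  exact: measurable_tail_integrand measurable_nu_off _.
have mf2 : measurable_fun setT f2 by apply: measurable_funM.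
have mf3 : measurable_fun setT f3.
  by apply: measurable_funM => //; exact: measurable_tail_integrand.
have f10 y : (0 <= f1 y)%R by rewrite mulr_ge0// nu_off_ge0.
have f20 y : (0 <= f2 y)%R by rewrite mulr_ge0.
have f30 y : (0 <= f3 y)%R by rewrite !mulr_ge0.
have le123 y : (nu y * (r <= enorm y)%R%:R <= f1 y + f2 y + f3 y)%R.
  case: (leP r (enorm y)) => ry; last by rewrite mulr0 !addr_ge0.
  rewrite mulr1; case sS : (off_gap (enorm y)).
    rewrite -[leLHS]addr0 lerD//.
    have [lry|lry] := leP (lam * r)%R (enorm y).
      by rewrite /f1 lry /nu_off sS !mulr1 lerDl.
    rewrite -[leLHS]add0r lerD// /f2 indicE mem_set; last first.
      by apply: box_enorm; exact: ltW.
    rewrite mulr1 nu_radial.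
    have y0 : (0 < enorm y)%R by exact: lt_le_trans ry.
    apply: le_trans (HC _ _ _ y0 (ltW lry) sS Ew) _.
    rewrite /m ler_wpM2r ?invr_ge0 ?mulr_ge0 ?powR_ge0 ?exprn_ge0 ?(ltW lamr0)//.
    by rewrite ler_wpM2l ?mulr_ge0 ?(ltW C0)//; exact: le0_ler_powR.
  move/negbT: sS; rewrite negb_or -!leNgt => /andP[Ry yR].
  by rewrite -[leLHS]add0r lerD ?addr_ge0// /f3 Ry (le_trans ry yR) !mulr1.
rewrite tail_integralE.
apply: (@le_trans _ _ (\int[lebesgue_tuple R d]_y ((f1 y)%:E + (f2 y)%:E + (f3 y)%:E))).
  apply: ge0_le_integral => //.
  - by move=> y _; rewrite lee_fin mulr_ge0.
  - by apply/measurable_EFinP; exact: measurable_tail_integrand.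
  - by apply: emeasurable_funD; [apply: emeasurable_funD|]; exact/measurable_EFinP.
  - by move=> y _; rewrite -!EFinD lee_fin.
rewrite ge0_integralD//; last 4 first.
- by move=> y _; rewrite -EFinD lee_fin addr_ge0.
- by apply: emeasurable_funD; exact/measurable_EFinP.
- by move=> y _; rewrite lee_fin.
- exact/measurable_EFinP.
rewrite ge0_integralD//; last 4 first.
- by move=> y _; rewrite lee_fin.
- exact/measurable_EFinP.
- by move=> y _; rewrite lee_fin.
- exact/measurable_EFinP.
rewrite -[X in X + _ + _]tail_integralE Ew.
apply: (@le_trans _ _ (w%:E + (D2 * w)%:E + (M / c1 * w)%:E)); last first.
  by rewrite -!EFinD -EFinM lee_fin !mulrDl mul1r.
apply: leeD; first apply: leeD => //.
  apply: (@le_trans _ _ (m%:E * lebesgue_tuple R d B)).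
    by apply: ge0_integral_le_indic.
  rewrite lebesgue_tuple_cube; last by rewrite -subr_ge0 opprK addr_ge0// ltW.
  rewrite -EFinM lee_fin (_ : lam * r - - (lam * r) = 2 * (lam * r))%R; last by ring.
  rewrite /m /D2 !exprMn powRM ?(ltW lam0) ?(ltW r0)//.
  rewrite le_eqVlt; apply/orP; left; apply/eqP.
  have ra : (0 < r `^ a)%R by exact: powR_gt0.
  have rd : (0 < r ^+ d)%R by exact: exprn_gt0.
  have la : (0 < lam `^ a)%R by exact: powR_gt0.
  have ld : (0 < lam ^+ d)%R by exact: exprn_gt0.
  move: ra rd la ld; move: (r `^ a)%R (r ^+ d)%R (lam `^ a)%R (lam ^+ d)%R (2 ^+ d)%R.
  by move=> ? ? ? ? ? ? ? ? ?; field; rewrite !gt_eqF.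
have [rR1|rR1] := leP r R1; last first.
  rewrite integral0_eq ?lee_fin ?mulr_ge0 ?invr_ge0 ?(ltW c10)// => y _.
  by rewrite /f3 (leNgt r R1) rR1/= mulr0.
under eq_integral do rewrite /f3 rR1 mulr1.
(* For r <= R1 monotonicity gives c1 <= w, hence M <= (M / c1) w. *)
rewrite -tail_integralE ME lee_fin mulrAC ler_pdivlMr// ler_wpM2l// -lee_fin -Ew.
apply: (le_trans Hc1); apply: le_tail_integral.
- exact: measurable_nu_off.
- exact: nu_off_ge0.
- by rewrite ler_pM2l.
Qed.

End radial_kernel.

(** * Absorption *)

(** By the triangle inequality |u| is at most twice the larger of |u - v| and |v|. *)
Lemma powR_norm_le_sub (R : realType) (p u v : R) : (0 <= p)%R ->
  (`|u| `^ p <= 2 `^ p * (`|u - v| `^ p + `|v| `^ p))%R.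
Proof.
move=> p0; have tri : (`|u| <= `|u - v| + `|v|)%R.
  by rewrite -{1}(subrK v u) ler_normD.
have u0 := normr_ge0 u; have v0 := normr_ge0 v; have uv0 := normr_ge0 (u - v)%R.
have h (q : R) : (0 <= q)%R -> (`|u| <= 2 * q)%R -> (`|u| `^ p <= 2 `^ p * q `^ p)%R.
  by move=> q0 uq; rewrite -powRM// ge0_ler_powR// nnegrE ?mulr_ge0.
have [le|le] := leP `|u - v|%R `|v|%R.
  apply: le_trans (h _ v0 _) _; first by lra.
  by rewrite ler_wpM2l ?powR_ge0// lerDr powR_ge0.
apply: le_trans (h _ uv0 _) _; first by lra.
by rewrite ler_wpM2l ?powR_ge0// lerDl powR_ge0.
Qed.

Section absorption.
Context (R : realType) (d : nat) (p lam : R) (kap f : Rvec R d -> R).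
Hypothesis p_ge0 : (0 <= p)%R.
Hypothesis lam4 : (4 <= lam)%R.
Hypothesis kap_meas : measurable_fun [set: Rvec R d] kap.
Hypothesis kap_ge0 : forall x, (0 <= kap x)%R.
Hypothesis kap_fin : forall r : R, (0 < r)%R -> tail_integral kap r < +oo.
(** The constant is half the inverse of the factor 2^p lost in splitting |f(x)|^p, so that exactly
    half of the left-hand side returns. *)
Hypothesis kap_near : forall y, (0 < enorm y)%R ->
  \int[lebesgue_tuple R d]_x
    (kap (tuple_sub x y) * (lam * enorm x <= enorm (tuple_sub x y))%R%:R)%:E <=
  ((2 `^ p)^-1 / 2)%:E * tail_integral kap (lam * enorm y).
Hypothesis f_meas : measurable_fun [set: Rvec R d] f.
Hypothesis f_fin : \int[lebesgue_tuple R d]_x (`|f x| `^ p)%:E < +oo.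

Let energy := \int[lebesgue_tuple R d]_y \int[lebesgue_tuple R d]_x
  (`|f x - f y| `^ p * kap (tuple_sub x y))%:E.

Let w (x : Rvec R d) := tail_integral kap (lam * enorm x).
Let fp (x : Rvec R d) := (`|f x| `^ p)%R.
Let h x := (fp x)%:E * w x.
Let far (delta : R) : set (Rvec R d) := [set x | (delta <= enorm x)%R].
(** Integration over the second variable gives the weight [w]; integration over the first gives the
    mass bounded in [kap_near]. *)
Let k (z : Rvec R d * Rvec R d) :=
  (kap (tuple_sub z.1 z.2) * (lam * enorm z.1 <= enorm (tuple_sub z.1 z.2))%R%:R)%R.

Let lam_gt0 : (0 < lam)%R.
Proof. exact: lt_le_trans lam4. Qed.

Let fp_ge0 x : (0 <= fp x)%R.
Proof. exact: powR_ge0. Qed.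

Let mnormp : measurable_fun setT (fun t : R => `|t| `^ p)%R.
Proof. exact: (measurableT_comp (measurable_powR p) (@normr_measurable R setT)). Qed.

Let mfp : measurable_fun [set: Rvec R d] fp.
Proof. exact: (measurableT_comp mnormp f_meas). Qed.

Let mlamE : measurable_fun [set: Rvec R d] (fun x => lam * enorm x)%R.
Proof. by apply: measurable_funM => //; exact: measurable_enorm. Qed.

Let mw : measurable_fun [set: Rvec R d] w.
Proof. exact: (measurable_tail_integral _ _ _ kap_meas kap_ge0 _ _ _ mlamE). Qed.

Let w_ge0 x : 0 <= w x.
Proof. exact: tail_integral_ge0. Qed.

Let h_ge0 x : 0 <= h x.
Proof. by rewrite mule_ge0// lee_fin. Qed.

Let mh : measurable_fun [set: Rvec R d] h.
Proof. by apply: emeasurable_funM => //; exact/measurable_EFinP. Qed.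

Let mkapsub : measurable_fun setT (fun z : Rvec R d * Rvec R d => kap (tuple_sub z.1 z.2)).
Proof. exact: (measurableT_comp kap_meas (measurable_tuple_sub R d)). Qed.

Let mk : measurable_fun setT k.
Proof.
apply: measurable_funM => //; apply: measurable_natr_bool; apply: measurable_fun_ler.
  exact: (measurableT_comp mlamE measurable_fst).
exact: (measurableT_comp (measurable_enorm R d) (measurable_tuple_sub R d)).
Qed.

Let k_ge0 z : (0 <= k z)%R.
Proof. by rewrite mulr_ge0. Qed.

Let mfar delta : measurable (far delta).
Proof. by rewrite -[X in measurable X]setTI; exact: measurable_enorm_ge. Qed.

(** The indicator of [far delta] as a real factor, so that Tonelli can be used on the whole
    space. *)
Let chi (delta : R) (x : Rvec R d) : R := (delta <= enorm x)%R%:R.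

Let mchi delta : measurable_fun setT (chi delta).
Proof. by apply: measurable_natr_bool; exact: measurable_enorm_ge. Qed.

Let chi_ge0 delta x : (0 <= chi delta x)%R.
Proof. by []. Qed.

Let integral_far delta : \int[lebesgue_tuple R d]_(x in far delta) h x =
  \int[lebesgue_tuple R d]_x ((chi delta x)%:E * h x).
Proof.
rewrite integral_mkcond; apply: eq_integral => y _.
rewrite patchE /chi; case: (leP delta (enorm y)) => ry.
  by rewrite mem_set// mul1e.
by rewrite memNset ?mul0e//=; apply/negP; rewrite -ltNge.
Qed.

(** The substitution of x - y for y moves the centre of the tail from the origin to x. *)
Let wE x : w x = \int[lebesgue_tuple R d]_y (k (x, y))%:E.
Proof.
rewrite /w tail_integralE.
rewrite -(ge0_integral_tuple_sub _ _ x (fun y => (kap y * (lam * enorm x <= enorm y)%R%:R)%:E))//.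
  by apply/measurable_EFinP; exact: measurable_tail_integrand.
by move=> y; rewrite lee_fin mulr_ge0.
Qed.

(* lam |x| <= |x - y| forces |x| <= |y|, so cutting off |x| < delta also cuts off
   |y| < delta. *)
Let near_far delta y : (0 < delta)%R ->
  \int[lebesgue_tuple R d]_x (chi delta x * k (x, y))%:E <=
  (chi delta y)%:E * (((2 `^ p)^-1 / 2)%:E * w y).
Proof.
move=> delta0; rewrite /chi; case: (leP delta (enorm y)) => dy.
  rewrite mul1e; apply: le_trans (kap_near y (lt_le_trans delta0 dy)).
  apply: ge0_le_integral => //.
  - by move=> x _; rewrite lee_fin mulr_ge0.
  - apply/measurable_EFinP; apply: measurable_funM; first exact: mchi.
    exact: (measurable_fun_pair1 y mk).
  - by apply/measurable_EFinP; exact: (measurable_fun_pair1 y mk).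
  - by move=> x _; rewrite lee_fin ler_piMl// lern1 leq_b1.
rewrite mul0e integral0_eq// => x _; congr EFin; rewrite /k/=.
have [dx|_] := leP delta (enorm x); last by rewrite mul0r.
have [lx|_] := leP (lam * enorm x)%R (enorm (tuple_sub x y)); last by rewrite !mulr0.
have x4 : (4 * enorm x <= lam * enorm x)%R by rewrite ler_wpM2r// enorm_ge0.
by exfalso; have := enorm_sub_le _ _ x y; lra.
Qed.

(** Away from the origin the weight is at most the finite tail at [lam] [delta], and |f|^p is
    integrable. This finiteness permits the subtraction in the absorption. *)
Let far_fin delta : (0 < delta)%R -> \int[lebesgue_tuple R d]_(x in far delta) h x < +oo.
Proof.
move=> delta0; have wfin := kap_fin _ (mulr_gt0 lam_gt0 delta0).
apply: (@le_lt_trans _ _ (tail_integral kap (lam * delta) *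
    \int[lebesgue_tuple R d]_x (fp x)%:E)); last first.
  by rewrite lte_mul_pinfty// ?tail_integral_ge0// ge0_fin_numE ?tail_integral_ge0.
rewrite integral_far -ge0_integralZl//; last 3 first.
- exact/measurable_EFinP.
- by move=> x _; rewrite lee_fin.
- exact: tail_integral_ge0.
apply: ge0_le_integral => //.
- by move=> x _; rewrite mule_ge0// lee_fin.
- by apply: emeasurable_funM => //; apply/measurable_EFinP; exact: mchi.
- by apply: measurable_funeM; exact/measurable_EFinP.
move=> x _; rewrite /chi; case: (leP delta (enorm x)) => dx.
  rewrite mul1e /h muleC lee_wpmul2r ?lee_fin//.
  by apply: le_tail_integral => //; rewrite ler_pM2l.
by rewrite mul0e mule_ge0 ?lee_fin// tail_integral_ge0.
Qed.

(** Writing J for the left side, Tonelli and the splitting of |f(x)|^p give J <= 2^p [energy] + J /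
    2. The resulting constant is independent of [delta]. *)
Let far_le delta : (0 < delta)%R ->
  \int[lebesgue_tuple R d]_(x in far delta) h x <= (2 * 2 `^ p)%:E * energy.
Proof.
move=> delta0.
have P0 : (0 < 2 `^ p :> R)%R by rewrite powR_gt0.
have mslice y : measurable_fun [set: Rvec R d]
    (fun x => (`|f x - f y| `^ p * kap (tuple_sub x y))%:E).
  apply/measurable_EFinP; apply: measurable_funM.
    apply: (measurableT_comp mnormp); exact: measurable_funB.
  exact: (measurable_fun_pair1 y mkapsub).
have mE : measurable_fun [set: Rvec R d] (fun y => \int[lebesgue_tuple R d]_x
    (`|f x - f y| `^ p * kap (tuple_sub x y))%:E).
  apply: (measurable_fun_fubini_tonelli_G (m1 := lebesgue_tuple R d)
    (fun z => (`|f z.1 - f z.2| `^ p * kap (tuple_sub z.1 z.2))%:E)).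
    apply/measurable_EFinP; apply: measurable_funM => //.
    apply: (measurableT_comp mnormp); apply: measurable_funB.
      exact: (measurableT_comp f_meas measurable_fst).
    exact: (measurableT_comp f_meas measurable_snd).
  by move=> z; rewrite lee_fin mulr_ge0 ?powR_ge0.
have slice0 y : 0 <= \int[lebesgue_tuple R d]_x (`|f x - f y| `^ p * kap (tuple_sub x y))%:E.
  by apply: integral_ge0 => x _; rewrite lee_fin mulr_ge0 ?powR_ge0.
set J := \int[lebesgue_tuple R d]_(x in far delta) h x.
have J0 : 0 <= J by apply: integral_ge0.
have JE : J = \int[lebesgue_tuple R d]_y \int[lebesgue_tuple R d]_x
    (chi delta x * fp x * k (x, y))%:E.
  rewrite /J integral_far -(fubini_tonelli (fun z => (chi delta z.1 * fp z.1 * k z)%:E)).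
  - apply: eq_integral => x _; rewrite /h muleA -EFinM wE -ge0_integralZl//.
    + by apply/measurable_EFinP; exact: (measurable_fun_pair2 x mk).
    + by move=> y _; rewrite lee_fin.
    + by rewrite lee_fin mulr_ge0.
  - apply/measurable_EFinP; apply: measurable_funM => //; apply: measurable_funM.
      exact: (measurableT_comp (mchi delta) measurable_fst).
    exact: (measurableT_comp mfp measurable_fst).
  - by move=> z; rewrite lee_fin !mulr_ge0.
(* In the difference term the cut-offs are simply dropped; in the |f(y)|^p term they are kept, so
   that [near_far] transfers the cut-off to y. *)
have slice y : \int[lebesgue_tuple R d]_x (chi delta x * fp x * k (x, y))%:E <=
    (2 `^ p)%:E * \int[lebesgue_tuple R d]_x (`|f x - f y| `^ p * kap (tuple_sub x y))%:E +
    (2^-1)%:E * ((chi delta y)%:E * h y).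
  have mck : measurable_fun [set: Rvec R d] (fun x => (chi delta x * k (x, y))%:E).
    apply/measurable_EFinP; apply: measurable_funM; first exact: mchi.
    exact: (measurable_fun_pair1 y mk).
  apply: (@le_trans _ _ (\int[lebesgue_tuple R d]_x
     ((2 `^ p)%:E * (`|f x - f y| `^ p * kap (tuple_sub x y))%:E +
      (2 `^ p * fp y)%:E * (chi delta x * k (x, y))%:E))).
    apply: ge0_le_integral => //.
    - by move=> x _; rewrite lee_fin !mulr_ge0.
    - apply/measurable_EFinP; apply: measurable_funM.
        by apply: measurable_funM => //; exact: mchi.
      exact: (measurable_fun_pair1 y mk).
    - by apply: emeasurable_funD; apply: measurable_funeM.
    move=> x _; rewrite -!EFinM -EFinD lee_fin.
    have kk : (k (x, y) <= kap (tuple_sub x y))%R by rewrite /k/= ler_piMr// lern1 leq_b1.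
    have c1 : (chi delta x <= 1)%R by rewrite lern1 leq_b1.
    have ck0 : (0 <= chi delta x * k (x, y))%R by rewrite mulr_ge0.
    apply: (@le_trans _ _
      (2 `^ p * (`|f x - f y| `^ p + `|f y| `^ p) * (chi delta x * k (x, y))))%R.
      by rewrite [leLHS]mulrAC [leLHS]mulrC ler_wpM2r// powR_norm_le_sub.
    rewrite mulrDr mulrDl lerD// [leRHS]mulrA ler_wpM2l ?mulr_ge0 ?powR_ge0//.
    by apply: le_trans kk; rewrite ler_piMl.
  rewrite ge0_integralD//; last 4 first.
  - by move=> x _; rewrite -EFinM lee_fin !mulr_ge0 ?powR_ge0.
  - exact: measurable_funeM.
  - by move=> x _; rewrite -EFinM lee_fin !mulr_ge0 ?powR_ge0.
  - exact: measurable_funeM.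
  rewrite ge0_integralZl//; last by move=> x _; rewrite lee_fin mulr_ge0 ?powR_ge0.
  rewrite ge0_integralZl//; last 2 first.
  - by move=> x _; rewrite lee_fin mulr_ge0.
  - by rewrite lee_fin mulr_ge0 ?powR_ge0.
  apply: leeD => //.
  apply: (@le_trans _ _ ((2 `^ p * fp y)%:E * ((chi delta y)%:E * (((2 `^ p)^-1 / 2)%:E * w y)))).
    by rewrite lee_wpmul2l ?near_far// lee_fin mulr_ge0 ?powR_ge0.
  rewrite /h !muleA -!EFinM.
  rewrite (_ : 2 `^ p * fp y * chi delta y * _ = 2^-1 * chi delta y * fp y)%R//.
  by field; rewrite gt_eqF.
have Jle : J <= (2 `^ p)%:E * energy + (2^-1)%:E * J.
  rewrite {1}JE; apply: (@le_trans _ _ (\int[lebesgue_tuple R d]_y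
    ((2 `^ p)%:E * \int[lebesgue_tuple R d]_x (`|f x - f y| `^ p * kap (tuple_sub x y))%:E +
    (2^-1)%:E * ((chi delta y)%:E * h y)))).
    apply: ge0_le_integral => //.
    - by move=> y _; apply: integral_ge0 => x _; rewrite lee_fin !mulr_ge0.
    - apply: (measurable_fun_fubini_tonelli_G (m1 := lebesgue_tuple R d)
        (fun z => (chi delta z.1 * fp z.1 * k z)%:E)).
        apply/measurable_EFinP; apply: measurable_funM => //; apply: measurable_funM.
          exact: (measurableT_comp (mchi delta) measurable_fst).
        exact: (measurableT_comp mfp measurable_fst).
      by move=> z; rewrite lee_fin !mulr_ge0.
    - apply: emeasurable_funD; apply: measurable_funeM => //.
      by apply: emeasurable_funM => //; apply/measurable_EFinP; exact: mchi.
  rewrite ge0_integralD//; last 4 first.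
  - by move=> y _; rewrite mule_ge0// lee_fin powR_ge0.
  - exact: measurable_funeM.
  - by move=> y _; rewrite !mule_ge0 ?lee_fin.
  - apply: measurable_funeM.
    by apply: emeasurable_funM => //; apply/measurable_EFinP; exact: mchi.
  rewrite ge0_integralZl//.
  rewrite ge0_integralZl//; last 2 first.
  - by apply: emeasurable_funM => //; apply/measurable_EFinP; exact: mchi.
  - by move=> y _; rewrite mule_ge0 ?lee_fin.
  by rewrite -integral_far.
(* Infinite energy is trivial; otherwise J is finite and J / 2 can be subtracted. *)
have := far_fin delta delta0; rewrite -/J.
have : 0 <= energy by apply: integral_ge0.
case: energy Jle => [e| |]//; last first.
  by move=> _ _ _; rewrite gt0_muley ?leey// lte_fin mulr_gt0.
case: (J) J0 => [j| |]// _ /[swap] _ /[swap] _.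
by rewrite -!EFinM -EFinD !lee_fin; lra.
Qed.

(** The sets |x| >= 1 / (n + 1) increase to the complement of the origin, and the uniform bound
    passes to the limit by monotone convergence. *)
Lemma weighted_integral_le_energy :
  \int[lebesgue_tuple R d]_(x in [set x | (0 < enorm x)%R])
    ((`|f x| `^ p)%:E * tail_integral kap (lam * enorm x)) <=
  (2 * 2 `^ p)%:E * \int[lebesgue_tuple R d]_y \int[lebesgue_tuple R d]_x
    (`|f x - f y| `^ p * kap (tuple_sub x y))%:E.
Proof.
pose F n := far n.+1%:R^-1.
have -> : [set x : Rvec R d | (0 < enorm x)%R] = \bigcup_n F n.
  apply/seteqP; split => x /=.
    move=> x0; exists (Num.truncn (enorm x)^-1) => //=; rewrite /F /far/=.
    by rewrite invf_ple ?posrE// ltW// truncnS_gt.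
  by move=> [n _]; apply: lt_le_trans; rewrite invr_gt0 ltr0n.
have cvgF : \int[lebesgue_tuple R d]_(x in F n) h x @[n --> \oo] -->
    \int[lebesgue_tuple R d]_(x in \bigcup_n F n) h x.
  apply: ge0_nondecreasing_set_cvg_integral => //.
  - move=> m n mn; apply/subsetPset => x; apply: le_trans.
    by rewrite lef_pV2 ?posrE ?ltr0n// ler_nat ltnS.
  - by move=> n; exact: mfar.
  - by move=> n; exact: measurable_funTS.
apply: cvge_le cvgF; apply: nearW => n; apply: far_le.
by rewrite invr_gt0 ltr0n.
Qed.

End absorption.

(** * The Hardy-type inequality for the original kernel *)

Theorem theorem3p5 (R : realType) (d : nat) (d_gt0 : (0 < d)%N)
  (p : R) (p_ge1 : (1 <= p)%R)
  (nu : Rvec R d -> R) (phi : R -> R)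
  (nu_meas : measurable_fun [set: Rvec R d] nu)
  (nu_ge0 : forall x, (0 <= nu x)%R)
  (nu_radial : forall x, nu x = phi (enorm x))
  (phi_gt0 : forall r : R, (0 < r)%R -> (0 < phi r)%R)
  (nu_levy : \int[lebesgue_tuple R d]_x (Num.min 1 (enorm x `^ p) * nu x)%:E
             < +oo)
  (nu_zero : (- d%:R - 1)%:E < lower_index_zero phi)
  (nu_infty : (- d%:R - 1)%:E < lower_index_infty phi) :
  exists2 c : R, (0 < c)%R &
    forall f : Rvec R d -> R, f \in Lfun (lebesgue_tuple R d) p%:E ->
      (\int[lebesgue_tuple R d]_x
         ((`|f x| `^ p)%:E * tail_integral nu (enorm x))) `^ p^-1
      <= c%:E *
         (\int[lebesgue_tuple R d]_y \int[lebesgue_tuple R d]_x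
            (`|f x - f y| `^ p * nu (tuple_sub x y))%:E) `^ p^-1.
Proof.
have p_gt0 : (0 < p)%R by exact: lt_le_trans p_ge1.
have p_ge0 := ltW p_gt0.
have [|a [A [R0 [R1 [a_gt a_le0 A_gt0 [R0_gt0 R01 phi_scaling]]]]]] :=
  global_scaling R phi phi_gt0 (- d%:R - 1)%R _ nu_zero nu_infty.
  by rewrite -opprD oppr_lt0 ltr_wpDl.
pose kap := nu_off R d nu R0 R1.
have kap_ge0 x : (0 <= kap x)%R by exact: nu_off_ge0.
have kap_meas : measurable_fun [set: Rvec R d] kap by exact: measurable_nu_off.
have kap_le x : (kap x <= nu x)%R by exact: nu_off_le.
have tail_fin r : (0 < r)%R -> tail_integral nu r < +oo.
  by move=> r0; apply: levy_tail_fin nu_levy.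
have kap_fin r : (0 < r)%R -> tail_integral kap r < +oo.
  move=> r0; apply: le_lt_trans (tail_fin r r0); rewrite !tail_integralE.
  apply: ge0_le_integral => //.
  - by move=> y _; rewrite lee_fin mulr_ge0.
  - by apply/measurable_EFinP; exact: measurable_tail_integrand.
  - by apply/measurable_EFinP; exact: measurable_tail_integrand.
  - by move=> y _; rewrite lee_fin ler_wpM2r.
have P0 : (0 < 2 `^ p :> R)%R by rewrite powR_gt0.
have theta_gt0 : (0 < (2 `^ p)^-1 / 2 :> R)%R by rewrite divr_gt0 ?invr_gt0.
have [lam lam4 near] := near_mass R d nu phi d_gt0 nu_meas nu_ge0 nu_radial phi_gt0
  a A R0 R1 a_gt a_le0 A_gt0 R0_gt0 R01 phi_scaling _ theta_gt0.
have lam1 : (1 <= lam)%R by apply: le_trans lam4; rewrite ler1n.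
have lam0 : (0 < lam)%R by exact: lt_le_trans lam1.
have [D D0 doubling] := tail_doubling R d nu phi d_gt0 nu_meas nu_ge0 nu_radial phi_gt0
  a A R0 R1 a_le0 A_gt0 R0_gt0 R01 phi_scaling lam lam1 tail_fin.
(* D converts the weight L into the dilated tail of [kap]; 2 2^p is the absorption constant. *)
pose C := (D * (2 * 2 `^ p))%R.
have C0 : (0 < C)%R by rewrite !mulr_gt0.
exists (C `^ p^-1)%R; first by rewrite powR_gt0.
move=> f fLp.
have mf : measurable_fun [set: Rvec R d] f.
  by have /sub_Lfun_mfun := fLp; rewrite inE.
have f_fin : \int[lebesgue_tuple R d]_x (`|f x| `^ p)%:E < +oo.
  have /integrableP[_] := Lfun_integrable p_ge1 fLp.
  by under eq_integral do rewrite gee0_abs ?lee_fin ?powR_ge0//.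
set I := (X in X `^ _ <= _); set E := (X in _ <= _ * X `^ _).
have I0 : 0 <= I.
  by apply: integral_ge0 => x _; rewrite mule_ge0 ?lee_fin ?powR_ge0// tail_integral_ge0.
have E0 : 0 <= E.
  by do 2 (apply: integral_ge0 => ? _); rewrite lee_fin mulr_ge0// powR_ge0.
(* Monotonicity and multiplicativity of the power 1/p reduce the claim to p-th powers. *)
suff IE : I <= C%:E * E.
  rewrite -poweR_EFin -poweRM ?lee_fin ?(ltW C0)//.
  apply: gt0_ler_poweR => //.
  - by rewrite invr_ge0.
  - by rewrite in_itv/= I0 leey.
  - by rewrite in_itv/= leey andbT mule_ge0// lee_fin ltW.
have mnormp : measurable_fun setT (fun t : R => `|t| `^ p)%R.
  exact: (measurableT_comp (measurable_powR p) (@normr_measurable R setT)).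
have mfp : measurable_fun [set: Rvec R d] (fun x => (`|f x| `^ p)%:E).
  by apply/measurable_EFinP; exact: (measurableT_comp mnormp mf).
have mE := measurable_enorm R d.
have mh : measurable_fun [set: Rvec R d]
    (fun x => (`|f x| `^ p)%:E * tail_integral nu (enorm x)).
  by apply: emeasurable_funM => //; exact: measurable_tail_integral.
have mhk : measurable_fun [set: Rvec R d]
    (fun x => (`|f x| `^ p)%:E * tail_integral kap (lam * enorm x)).
  apply: emeasurable_funM => //; apply: measurable_tail_integral => //.
  by apply: measurable_funM.
pose N := [set x : Rvec R d | enorm x = 0%R].
have mN : measurable N.
  by rewrite -[N]setTI; exact: (mE _ _ (measurable_set1 0%R)).
have NE : [set: Rvec R d] `\` N = [set x | (0 < enorm x)%R].
  apply/seteqP; split => x /=; first by move=> [_ /eqP]; rewrite lt0r enorm_ge0 andbT.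
  by move=> x0; split => //; rewrite /N/=; apply/eqP; rewrite gt_eqF.
have mpos : measurable [set x : Rvec R d | (0 < enorm x)%R].
  by rewrite -NE; exact: measurableD.
(* The tail comparison holds only for positive radii, so the null set at the origin is removed
   first. *)
rewrite /I (ge0_negligible_integral mN)//; first last.
- exact: enorm0_null.
- by move=> x _; rewrite mule_ge0 ?lee_fin ?powR_ge0// tail_integral_ge0.
rewrite NE; apply: (@le_trans _ _ (D%:E * \int[lebesgue_tuple R d]_(x in [set x | (0 < enorm x)%R])
    ((`|f x| `^ p)%:E * tail_integral kap (lam * enorm x)))).
  rewrite -ge0_integralZl//; last 3 first.
  - exact: measurable_funTS.
  - by move=> x _; rewrite mule_ge0 ?lee_fin ?powR_ge0// tail_integral_ge0.
  - by rewrite lee_fin ltW.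
  apply: ge0_le_integral => //.
  - by move=> x _; rewrite mule_ge0 ?lee_fin ?powR_ge0// tail_integral_ge0.
  - exact: measurable_funTS.
  - by apply: measurable_funeM; exact: measurable_funTS.
  - move=> x x0; rewrite muleCA lee_wpmul2l ?lee_fin ?powR_ge0//.
    exact: doubling.
have := weighted_integral_le_energy R d p lam kap f
  p_ge0 lam4 kap_meas kap_ge0 kap_fin near mf f_fin.
move=> h; rewrite /C EFinM -muleA lee_wpmul2l ?lee_fin ?(ltW D0)//.
(* What remains is that the energy of [kap] is at most that of [nu], from [kap] <= [nu]
   pointwise. *)
apply: (le_trans h); rewrite lee_wpmul2l ?lee_fin ?mulr_ge0 ?powR_ge0//.
have mdiff g : measurable_fun [set: Rvec R d] g ->
    measurable_fun setT (fun z : Rvec R d * Rvec R d =>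
      (`|f z.1 - f z.2| `^ p * g (tuple_sub z.1 z.2))%:E).
  move=> mg; apply/measurable_EFinP; apply: measurable_funM.
    apply: (measurableT_comp mnormp); apply: measurable_funB.
      exact: (measurableT_comp mf measurable_fst).
    exact: (measurableT_comp mf measurable_snd).
  exact: (measurableT_comp mg (measurable_tuple_sub R d)).
have diff0 g x y : (forall z, 0 <= g z)%R ->
    0 <= (`|f x - f y| `^ p * g (tuple_sub x y))%:E.
  by move=> g0; rewrite lee_fin mulr_ge0 ?powR_ge0.
apply: ge0_le_integral => //.
- by move=> y _; apply: integral_ge0 => x _; exact: diff0.
- apply: (measurable_fun_fubini_tonelli_G (m1 := lebesgue_tuple R d) _ (mdiff kap kap_meas)).
  by move=> z; exact: diff0.
- apply: (measurable_fun_fubini_tonelli_G (m1 := lebesgue_tuple R d) _ (mdiff nu nu_meas)).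
  by move=> z; exact: diff0.
move=> y _; apply: ge0_le_integral => //.
- by move=> x _; exact: diff0.
- exact: (measurable_fun_pair1 y (mdiff kap kap_meas)).
- exact: (measurable_fun_pair1 y (mdiff nu nu_meas)).
- by move=> x _; rewrite lee_fin ler_wpM2l ?powR_ge0.
Qed.
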